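(* Let $\mathcal{T}$ be a simplicial (or cubical) complex, let $L$ be a discrete vector bundle on $\mathcal{T}$ with a discrete connection $\mathsf{t}$ (not assumed flat), let $\mathcal{S}$ be the cubical refinement of $\mathcal{T}$, and equip the discrete vector bundle $\mathrm{End}(L)$ on $\mathcal{S}$ with the discrete connection induced by $\mathsf{t}$. Then the curvature $\mathsf{c}_{\mathsf{t}}$ of $(L,\mathsf{t})$, which is an element of $\mathcal{C}^2(\mathcal{S},\mathrm{End}(L))$, has zero discrete covariant exterior derivative: $\delta\, \mathsf{c}_{\mathsf{t}} = 0$ in $\mathcal{C}^3(\mathcal{S},\mathrm{End}(L))$.
   Context: **Cells and orientations.** $\mathcal{T}$ is a finite cellular complex all of whose cells are simplices (or all cubes). $T'\trianglelefteq T$ means that $T'$ is a subcell (face) of $T$. Each cell of dimension at least one is oriented; the relative orientation $\mathrm{o}(T,T')$ is $\pm1$ if $T'$ is a codimension 1 face of $T$ and $0$ otherwise (the usual incidence numbers of the cellular cochain complex). If $T''$ is a codimension 2 face of $T$, there are exactly two codimension 1 faces $T'_0,T'_1$ of $T$ having $T''$ as a codimension 1 face. **Discrete vector bundle with connection.** A discrete vector bundle $L$ on a cellular complex is a choice of a vector space $L(T)$ for each cell $T$. A discrete connection $\mathsf{t}$ is a choice of isomorphism $\mathsf{t}_{TT'}:L(T')\to L(T)$ for each pair of cells with $T'$ a codimension 1 face of $T$. The space of $k$-cochains with coefficients is $\mathcal{C}^k(\mathcal{T},L)=\prod_{T\in\mathcal{T}^k}L(T)$, where $\mathcal{T}^k$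 is the set of $k$-dimensional cells. The discrete covariant exterior derivative $\mathcal{C}^k(\mathcal{T},L)\to\mathcal{C}^{k+1}(\mathcal{T},L)$ is $(\delta_{\mathsf{t}}u)(T)=\sum_{T'\trianglelefteq T}\mathrm{o}(T,T')\,\mathsf{t}_{TT'}u(T')$ (sum over codimension 1 faces). **Cubical refinement.** Choose for each cell $T$ a point $b_T$ in its interior. For cells $T''\trianglelefteq T'$ of $\mathcal{T}$, $S(T'',T')$ is the union of the simplices $[b_{T_0},\ldots,b_{T_k}]$ with $T''\trianglelefteq T_0\trianglelefteq\cdots\trianglelefteq T_k\trianglelefteq T'$ (the $T_i$ distinct). Combinatorially it is a cube of dimension $\dim T'-\dim T''$, whose vertices are the $b_{T_0}$ with $T''\trianglelefteq T_0\trianglelefteq T'$; its smallest vertex is $b_{T''}$ and its largest is $b_{T'}$. Its faces are the $S(U'',U')$ with $T''\trianglelefteq U''\trianglelefteq U'\trianglelefteq T'$. The cubes $S(T'',T')$ form a cellular complex $\mathcal{S}$, the cubical refinement of $\mathcal{T}$; its cells are given orientations. **Bundle of endomorphisms.** $\mathrm{End}(L)$ is the discrete vector bundle on $\mathcal{S}$ whose fiber at $S(T'',T')$ is the space of linear maps $L(T'')\to L(T')$. Its induced transport operators, denoted $\mathsf{t}^{\mathrm{End}}_{SS'}:\mathrm{End}(L)(S')\to\mathrm{End}(L)(S)$, are as follows. Let $S=S(T'',T')$ and let $S'$ be a codimension 1 face of $S$. Either $S'=S(T'',T_0)$ with $T_0$ a codimension 1 face of $T'$, and then the transport from $S'$ to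 $S$ is $u\mapsto\mathsf{t}_{T'T_0}\circ u$; or $S'=S(T_0,T')$ with $T''$ a codimension 1 face of $T_0$, and then it is $u\mapsto u\circ\mathsf{t}_{T_0T''}$. The discrete covariant exterior derivative $\delta:\mathcal{C}^k(\mathcal{S},\mathrm{End}(L))\to\mathcal{C}^{k+1}(\mathcal{S},\mathrm{End}(L))$ is defined, for each $(k+1)$-dimensional cube $S$ of $\mathcal{S}$, by $(\delta u)(S)=\sum_{S'}\mathrm{o}(S,S')\,\mathsf{t}^{\mathrm{End}}_{SS'}u(S')$, where the sum is over the codimension 1 faces $S'$ of $S$ and $\mathrm{o}(S,S')=\pm1$ denotes the relative orientation of $S$ and $S'$ in $\mathcal{S}$. **Curvature.** $\mathsf{c}_{\mathsf{t}}\in\mathcal{C}^2(\mathcal{S},\mathrm{End}(L))$ assigns to the square $S(T'',T)$, where $T''$ is a codimension 2 face of $T$, the linear map $L(T'')\to L(T)$ $$\mathsf{c}_{\mathsf{t}}(T,T'')=\pm\big(\mathsf{t}_{TT'_0}\mathsf{t}_{T'_0T''}-\mathsf{t}_{TT'_1}\mathsf{t}_{T'_1T''}\big),$$ where the sign is given by the orientation of the square $S(T'',T)$: it is $+$ if the oriented boundary of the square runs through $b_{T''},b_{T'_0},b_T,b_{T'_1}$ in this cyclic order, and $-$ otherwise. (The squares may be oriented so that the orientations of the transverse cells $T''$ and $S(T'',T)$ induce that of $T$.) *)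

(* Defs.v *)
From HB Require Import structures.
From mathcomp Require Import all_boot all_order all_algebra.
From mathcomp Require Import boolp.

Set Implicit Arguments.
Unset Strict Implicit.
Unset Printing Implicit Defensive.

Import Order.TTheory GRing.Theory.
Local Open Scope ring_scope.

(* A finite cellular complex is given by its face poset X together with the   *)
(* dimensions of the cells; (T' <= T)%O means that T' is a subcell of T.       *)
(* The complex being regular, it is determined up to homeomorphism by these   *)
(* data. Its orientation plays no role in the curvature and is not recorded.  *)

Section Cells.
Context {d : Order.disp_t} {X : finPOrderType d}.
Implicit Types (dim : X -> nat) (T : X).

Definition codim_face dim (k : nat) (T' T : X) : bool :=
  (T' <= T)%O && (dim T == dim T' + k)%N.

Definition k_cell dim (k : nat) := {T : X | dim T == k}.

(* The faces of an n-simplex are the nonempty sets of its n + 1 vertices.     *)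
Definition simplex_cell dim T : Prop :=
  exists f : {set 'I_(dim T).+1} -> X,
    (forall U, (U <= T)%O <-> exists2 A, A != set0 & f A = U) /\
    (forall A B, A != set0 -> B != set0 -> (f A <= f B)%O = (A \subset B)).

(* The faces of the n-cube [0,1]^n are products of n factors, each of which   *)
(* is {0}, {1} or [0,1], encoded by Some false, Some true and None.           *)
Definition cube_cell dim T : Prop :=
  exists f : {ffun 'I_(dim T) -> option bool} -> X,
    (forall U, (U <= T)%O <-> exists A, f A = U) /\
    (forall A B, (f A <= f B)%O =
                 [forall i, (B i == None) || (A i == B i)]).

Definition simplicial_complex dim : Prop := forall T, simplex_cell dim T.
Definition cubical_complex dim : Prop := forall T, cube_cell dim T.

End Cells.

Section LinearMaps.
Variables (K : fieldType) (U V : lmodType K).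

(* The vector space of linear maps from U to V.                               *)
Definition Lin := {linear U -> V}.

Implicit Types f g h : Lin.

Lemma LinP f g : f =1 g -> f = g.
Proof.
case: f g => [f [[fD] [fZ]]] [g [[gD] [gZ]]] /= /funext fg.
case: g / fg gD gZ => gD gZ.
by rewrite (Prop_irrelevance fD gD) (Prop_irrelevance fZ gZ).
Qed.

Definition lin_zero : Lin := \0.
Definition lin_opp f : Lin := \- f.
Definition lin_add f g : Lin := f \+ g.
Definition lin_scale (a : K) f : Lin := a \*: f.

HB.instance Definition _ := gen_eqMixin Lin.
HB.instance Definition _ := gen_choiceMixin Lin.

Fact lin_addA : associative lin_add.
Proof. by move=> f g h; apply: LinP => x /=; rewrite addrA. Qed.
Fact lin_addC : commutative lin_add.
Proof. by move=> f g; apply: LinP => x /=; rewrite addrC. Qed.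
Fact lin_add0 : left_id lin_zero lin_add.
Proof. by move=> f; apply: LinP => x /=; rewrite add0r. Qed.
Fact lin_addN : left_inverse lin_zero lin_opp lin_add.
Proof. by move=> f; apply: LinP => x /=; rewrite addNr. Qed.

HB.instance Definition _ :=
  GRing.isZmodule.Build Lin lin_addA lin_addC lin_add0 lin_addN.

Fact lin_scaleA a b f : lin_scale a (lin_scale b f) = lin_scale (a * b) f.
Proof. by apply: LinP => x /=; rewrite scalerA. Qed.
Fact lin_scale1 : left_id 1 lin_scale.
Proof. by move=> f; apply: LinP => x /=; rewrite scale1r. Qed.
Fact lin_scaleDr : right_distributive lin_scale +%R.
Proof. by move=> a f g; apply: LinP => x /=; rewrite scalerDr. Qed.
Fact lin_scaleDl f : {morph lin_scale^~ f : a b / a + b}.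
Proof. by move=> a b; apply: LinP => x /=; rewrite scalerDl. Qed.

HB.instance Definition _ := GRing.Zmodule_isLmodule.Build K Lin
  lin_scaleA lin_scale1 lin_scaleDr lin_scaleDl.

Lemma lin0E x : (0 : Lin) x = 0. Proof. by []. Qed.
Lemma linDE f g x : (f + g) x = f x + g x. Proof. by []. Qed.
Lemma linNE f x : (- f) x = - f x. Proof. by []. Qed.
Lemma linZE a f x : (a *: f) x = a *: f x. Proof. by []. Qed.

End LinearMaps.

Definition lin_comp (K : fieldType) (U V W : lmodType K)
  (g : Lin V W) (f : Lin U V) : Lin U W := g \o f.

Section Bundles.
Context {d : Order.disp_t} {X : finPOrderType d}.
Variables (dim : X -> nat) (K : fieldType).

Definition bundle := X -> lmodType K.

Implicit Types L : bundle.

(* t T T' maps L T' to L T; only the values at pairs where T' is a            *)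
(* codimension 1 face of T are meaningful.                                    *)
Definition transport L := forall T T' : X, Lin (L T') (L T).

Definition is_connection L (t : transport L) : Prop :=
  forall T T', codim_face dim 1 T' T -> bijective (t T T').

Definition cochain (k : nat) L := forall T : k_cell dim k, L (val T).

(* o T T' is the relative orientation of T and T'.                            *)
Definition covariant_derivative (o : X -> X -> int) L (t : transport L) (k : nat)
    (u : cochain k L) : cochain k.+1 L :=
  fun T => \sum_(T' : k_cell dim k | codim_face dim 1 (val T') (val T))
             t (val T) (val T') (u T') *~ o (val T) (val T').

End Bundles.

Section Refinement.
Context {d : Order.disp_t} {X : finPOrderType d}.

(* The cube S(T'', T') is represented by the pair (T'', T').                  *)
Definition cube (Y : finPOrderType d) := {S : Y * Y | (S.1 <= S.2)%O}.

HB.instance Definition _ := Finite.on (cube X).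

Definition lo (S : cube X) : X := (val S).1.
Definition hi (S : cube X) : X := (val S).2.

Definition cube_le (S' S : cube X) : bool := (lo S <= lo S')%O && (hi S' <= hi S)%O.

Fact cube_le_refl : reflexive cube_le.
Proof. by move=> S; rewrite /cube_le !lexx. Qed.
Fact cube_le_anti : antisymmetric cube_le.
Proof.
move=> S S' /andP[/andP[a b] /andP[c e]]; apply: val_inj.
rewrite [LHS]surjective_pairing [RHS]surjective_pairing; congr pair; apply: le_anti.
  by rewrite [X in X && _]c [X in _ && X]a.
by rewrite [X in X && _]b [X in _ && X]e.
Qed.
Fact cube_le_trans : transitive cube_le.
Proof.
move=> S2 S1 S3 /andP[a b] /andP[c e].
by rewrite /cube_le (le_trans c a) (le_trans b e).
Qed.

Fact refinement_display : Order.disp_t. Proof. exact: Order.Disp tt tt. Qed.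

HB.instance Definition _ := Order.Le_isPOrder.Build refinement_display (cube X)
  cube_le_refl cube_le_anti cube_le_trans.

Variable dim : X -> nat.

Definition cube_dim (S : cube X) : nat := (dim (hi S) - dim (lo S))%N.

(* The vertex b_T.                                                            *)
Definition vertex (T : X) : cube X := Sub (T, T) (lexx T).

(* The edges of S issued from its smallest vertex are the S(lo S, a), for the *)
(* following cells a. They give coordinates on S: on the vertex b_T of S, the *)
(* coordinate along a is 1 if a is a face of T and 0 otherwise.               *)
Definition directions (S : cube X) : {set X} :=
  [set a | codim_face dim 1 (lo S) a && (a <= hi S)%O].

Definition frame (S : cube X) (s : seq X) : bool := perm_eq s (enum (directions S)).

(* An orientation of a cube tells which of its frames are positive; points    *)
(* carry the canonical orientation.                                           *)
Record orientation := Orientation {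
  positive : cube X -> seq X -> bool;
  positive_swap : forall S s1 s2 a b, frame S (s1 ++ [:: a, b & s2]) ->
    positive S (s1 ++ [:: b, a & s2]) = ~~ positive S (s1 ++ [:: a, b & s2]);
  positive_vertex : forall T, positive (vertex T) [::]
}.

(* Let S' be a codimension 1 face of S. It is defined in S by the equation    *)
(* a = 0 or a = 1 for one direction a of S, the normal direction, which is    *)
(* outward in the second case and inward in the first one. The other          *)
(* directions of S are parallel to those of S'.                               *)
Definition normal_direction (S S' : cube X) : X :=
  odflt (lo S) [pick a in directions S | ~~ (a <= hi S')%O || (a <= lo S')%O].

Definition parallel_direction (S S' : cube X) (c : X) : X :=
  odflt (lo S) [pick b in directions S | (b <= c)%O && ~~ (b <= lo S')%O].

Definition outward_sign (S S' : cube X) : int :=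
  if (normal_direction S S' <= lo S')%O then 1 else -1.

Variable o : orientation.

Definition frame_sign (S : cube X) (s : seq X) : int :=
  if positive o S s then 1 else -1.

(* The sign is that of the outward normal followed by a positive frame of S', *)
(* seen as a frame of S.                                                      *)
Definition relative_orientation (S S' : cube X) : int :=
  if codim_face cube_dim 1 S' S then
    let s := enum (directions S') in
    outward_sign S S' * frame_sign S' s *
    frame_sign S (normal_direction S S' :: [seq parallel_direction S S' c | c <- s])
  else 0.

(* The oriented boundary of the square S runs through the edge of vertices    *)
(* b_T and b_U, from b_T to b_U.                                              *)
Definition boundary_runs (S : cube X) (T U : X) : bool :=
  [exists E : cube X,
    [&& codim_face cube_dim 1 E S, (vertex T <= E)%O, (vertex U <= E)%O, T != U &
        relative_orientation S E * relative_orientation E (vertex U) == 1]].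

Variables (K : fieldType) (L : @bundle d X K).

Definition End_bundle : @bundle _ (cube X) K := fun S => Lin (L (lo S)) (L (hi S)).

(* The identity map of L T, if T = T'.                                        *)
Definition fibre_cast (T T' : X) : Lin (L T) (L T') :=
  match T =P T' with
  | ReflectT e => match e in _ = T0 return Lin (L T) (L T0) with
                  | erefl => (idfun : {linear L T -> L T})
                  end
  | ReflectF _ => 0
  end.

Lemma fibre_cast_id (T : X) (x : L T) : fibre_cast T T x = x.
Proof. by rewrite /fibre_cast; case: eqP => // e; rewrite (eq_axiomK e). Qed.

Variable t : transport L.

(* u |-> t_{T' T0} o u on the faces S(T'', T0) of S(T'', T'), and             *)
(* u |-> u o t_{T0 T''} on the faces S(T0, T'), up to the identification of   *)
(* the fibres of L at equal cells.                                            *)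
Definition End_transport_fun (S S' : cube X) (u : End_bundle S') : End_bundle S :=
  if lo S' == lo S
  then lin_comp (t (hi S) (hi S')) (lin_comp u (fibre_cast (lo S) (lo S')))
  else lin_comp (fibre_cast (hi S') (hi S)) (lin_comp u (t (lo S') (lo S))).

Fact End_transport_linear S S' : linear (@End_transport_fun S S').
Proof.
move=> a u v; rewrite /End_transport_fun; case: ifP => _; apply: LinP => x;
  by rewrite linDE linZE /= ?linDE ?linZE linearP.
Qed.

HB.instance Definition _ S S' := GRing.isLinear.Build K (End_bundle S') (End_bundle S)
  _ (@End_transport_fun S S') (@End_transport_linear S S').

Definition End_transport : transport End_bundle := fun S S' => @End_transport_fun S S'.

(* There are exactly two cells between lo S and hi S when S is a square; the  *)
(* value below does not depend on which one of them is listed first.          *)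
Definition curvature : cochain cube_dim 2 End_bundle := fun Q =>
  let S := val Q in
  if enum [set T' | codim_face dim 1 (lo S) T' && codim_face dim 1 T' (hi S)]
     is [:: T0; T1]
  then (lin_comp (t (hi S) T0) (t T0 (lo S)) - lin_comp (t (hi S) T1) (t T1 (lo S)))
         *~ (if cycle (boundary_runs S) [:: lo S; T0; hi S; T1] then 1 else -1)
  else 0.

End Refinement.

(* Main.v *)
(* In a simplicial or cubical complex every interval [x, z] of the face poset *)
(* is Boolean. On a 3-cube S(x, z), the two terms of the curvature at each of *)
(* the six square faces thus become, after transport, compositions along      *)
(* maximal chains x < a < v < z, with a sign. The six such chains form a      *)
(* hexagon, two consecutive ones differing in either a or v, i.e. by one      *)
(* square face. With the sign of the face, its contribution is the            *)
(* difference of the two chains, always in the same direction around the      *)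
(* hexagon, so that the sum telescopes.                                       *)
Require Import Defs.
From mathcomp Require Import all_boot all_order all_algebra.

Set Implicit Arguments.
Unset Strict Implicit.
Unset Printing Implicit Defensive.

Import Order.TTheory GRing.Theory.
Local Open Scope ring_scope.

(** This is the Bianchi identity. Let S = S(x, z) be a 3-cube whose edges at [lo S] lead to the
    cells a, b, c, write ab, ac, bc for the cells of the next rank, and let P(u, v) be the transport
    along x < u < v < z ([transport_path]). Since the interval is Boolean ([boolean_complex]), S has
    exactly six square faces, and the curvature of each, once transported to S, is a signed
    difference of two such paths.

    The signs are the heart of the matter. A frame sign of the face occurs twice: in the curvature
    ([curvatureE]) and in the incidence number ([relative_orientation_lower],
    [relative_orientation_upper]). It squares to 1, so only the sign of the frame (a, b, c) of S
    remains. Up to that sign, the face at c = 0 contributes P(b, ab) - P(a, ab) ([lower_face]) and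
    the face at a = 1 contributes P(a, ab) - P(a, ac) ([upper_face]). The other four faces follow by
    cyclic permutation of a, b, c, which is even and preserves the sign. The six differences run
    once around the hexagon of paths and cancel. *)

Section Intervals.
Context {d : Order.disp_t} {X : finPOrderType d}.
Variable dim : X -> nat.

(** * Boolean intervals of the face poset *)

Definition boolean_interval (x z : X) : Prop :=
  exists (I : finType) (D : {set I}) (f : {set I} -> X),
    [/\ forall u, (x <= u <= z)%O <-> exists2 B : {set I}, B \subset D & f B = u,
        {in powerset D &, forall A B, (f A <= f B)%O = (A \subset B)} &
        {in powerset D, forall B, dim (f B) = (dim x + #|B|)%N}].

(* The dimension of a cell is recovered from the number of its faces, which   *)
(* is 2^(n+1) - 1 for an n-simplex and 3^n for an n-cube.                     *)
Lemma card_simplex_faces (I : finType) (f : {set I} -> X) (T : X) (A : {set I}) :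
  (forall U, (U <= T)%O <-> exists2 A : {set _}, A != set0 & f A = U) ->
  (forall A B, A != set0 -> B != set0 -> (f A <= f B)%O = (A \subset B)) ->
  A != set0 -> #|[set U | (U <= f A)%O]|.+1 = (2 ^ #|A|)%N.
Proof.
move=> fT fle A0; rewrite -card_powerset (cardsD1 set0) powersetE sub0set.
rewrite add1n; congr _.+1; rewrite -(@card_in_imset _ _ f); last first.
  move=> B C /setD1P[B0 _] /setD1P[C0 _] fBC; apply/eqP.
  by rewrite eqEsubset -!fle // fBC lexx.
apply: eq_card => U; rewrite inE; apply/idP/imsetP => [leU|[B /setD1P[B0 BA] ->]].
  have leT : (f A <= T)%O by apply/fT; exists A.
  have /fT[B B0 eU] := le_trans leU leT; exists B => //.
  by rewrite in_setD1 B0 powersetE -fle // eU.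
by rewrite fle // -powersetE.
Qed.

Lemma card_simplex_cell (T : X) :
  simplex_cell dim T -> #|[set U | (U <= T)%O]|.+1 = (2 ^ (dim T).+1)%N.
Proof.
move=> [f [fT fle]].
have T0 : [set: 'I_(dim T).+1] != set0 by apply/set0Pn; exists ord0; rewrite inE.
have leT : (f setT <= T)%O by apply/fT; exists setT.
have [B B0 eB] : exists2 B, B != set0 & f B = T by apply/fT.
have eT : f setT = T.
  apply: le_anti; rewrite leT -[X in (X <= _)%O]eB fle //; exact: subsetT.
have -> : [set U | (U <= T)%O] = [set U | (U <= f setT)%O] by rewrite eT.
by rewrite (card_simplex_faces fT fle T0) cardsT card_ord.
Qed.

(** If x has vertex set [A0] in z, a cell between x and z amounts to the set of vertices it adds to
    [A0]; hence [D] is the complement of [A0]. *)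
Lemma simplicial_boolean (x z : X) :
  simplicial_complex dim -> (x <= z)%O -> boolean_interval x z.
Proof.
move=> cplx le_xz; have [f [fT fle]] := cplx z.
(* [f] parametrizes the faces of z only, whereas [dim (f A)] is tied to the parametrization of the
   cell [f A] itself. Counting the faces of [f A] in both ways compares the two. *)
have fdim A : A != set0 -> (dim (f A)).+1 = #|A|.
  move=> A0; apply/eqP; rewrite -(eqn_exp2l _ _ (ltnSn 1)).
  by rewrite -(card_simplex_cell (cplx _)) (card_simplex_faces fT fle).
have [A0 A0n ex] : exists2 A, A != set0 & f A = x by apply/fT.
have U0 B : A0 :|: B != set0.
  by rewrite setU_eq0 negb_and A0n.
exists 'I_(dim z).+1, (~: A0), (fun B => f (A0 :|: B)); split.
- move=> u; split=> [/andP[]|[B _ <-]].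
    move=> le_xu /fT[A An eu]; subst u x.
    move: le_xu; rewrite fle // => sA.
    exists (A :\: A0); first by rewrite subDset setUCr subsetT.
    by rewrite setDE setUIr setUCr setIT (setUidPr sA).
  apply/andP; split; first by rewrite -ex fle // subsetUl.
  by apply/fT; exists (A0 :|: B).
- move=> A B; rewrite !powersetE => sA sB; rewrite fle // subUset subsetUl /=.
  by rewrite -subDset setDE (setIidPl sA).
- move=> B; rewrite powersetE => sB; apply: succn_inj.
  rewrite fdim // -addSn -ex fdim // cardsU -[RHS]subn0; congr subn.
  by apply/eqP; rewrite cards_eq0 setI_eq0 disjoint_sym disjoints_subset.
Qed.

Lemma card_cube_faces (I : finType) (f : {ffun I -> option bool} -> X) (T : X)
    (A : {ffun I -> option bool}) :
  (forall U, (U <= T)%O <-> exists A, f A = U) ->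
  (forall A B, (f A <= f B)%O = [forall i, (B i == None) || (A i == B i)]) ->
  #|[set U | (U <= f A)%O]| = (3 ^ #|[set i | A i == None]|)%N.
Proof.
move=> fT fle.
have finj : injective f.
  move=> B C fBC; have := lexx (f B); rewrite {2}fBC fle => /forallP BC.
  have := lexx (f C); rewrite -{2}fBC fle => /forallP CB; apply/ffunP => i.
  have := BC i; have := CB i.
  by case: (B i) (C i) => [[]|] [[]|].
(* The faces of [f A] form a product: a free coordinate of [A] allows three values, a fixed one a
   single value. *)
pose F i := [pred c : option bool | (A i == None) || (c == A i)].
have -> : [set U | (U <= f A)%O] = f @: [set B in family F].
  apply/setP => U; rewrite inE; apply/idP/imsetP => [leU|[B]].
    have leT : (f A <= T)%O by apply/fT; exists A.
    have /fT[B eU] := le_trans leU leT; exists B => //.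
    rewrite inE; apply/forallP => i; move: leU; rewrite -eU fle => /forallP/(_ i).
    by [].
  rewrite inE => /forallP FB ->; rewrite fle; apply/forallP => i; exact: FB i.
rewrite card_imset // cardsE card_family foldrE big_map big_enum /=.
rewrite (bigID (fun i => A i == None)) /= [X in (_ * X)%N]big1 ?muln1.
  rewrite (eq_bigr (fun=> 3)) ?prod_nat_const.
    by congr (_ ^ _)%N; apply: eq_card => i; rewrite !inE.
  move=> i /eqP Ai; rewrite (@eq_card _ _ predT) => [|c]; last by rewrite !inE Ai.
  by rewrite card_option card_bool.
move=> i Ai; rewrite -(card1 (A i)); apply: eq_card => c.
by rewrite !inE (negPf Ai).
Qed.

Lemma card_cube_cell (T : X) :
  cube_cell dim T -> #|[set U | (U <= T)%O]| = (3 ^ dim T)%N.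
Proof.
move=> [f [fT fle]]; pose N := [ffun _ : 'I_(dim T) => @None bool].
have leT : (f N <= T)%O by apply/fT; exists N.
have [B eB] : exists B, f B = T by apply/fT.
have eT : f N = T.
  apply: le_anti; rewrite leT -[X in (X <= _)%O]eB fle; apply/forallP => i.
  by rewrite ffunE.
have -> : [set U | (U <= T)%O] = [set U | (U <= f N)%O] by rewrite eT.
rewrite (card_cube_faces _ fT fle); congr (_ ^ _)%N.
rewrite -[RHS]card_ord -cardsT; congr #|pred_of_set _|.
by apply/setP => i; rewrite !inE ffunE.
Qed.

(** A cell between x and z is obtained by freeing some of the coordinates that are fixed on x; [D]
    collects these coordinates and [h B] frees those in [B]. *)
Lemma cubical_boolean (x z : X) :
  cubical_complex dim -> (x <= z)%O -> boolean_interval x z.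
Proof.
move=> cplx le_xz; have [f [fT fle]] := cplx z.
have fdim A : dim (f A) = #|[set i | A i == None]|.
  apply/eqP; rewrite -(eqn_exp2l _ _ (isT : 1 < 3)%N).
  by rewrite -(card_cube_cell (cplx _)) (card_cube_faces _ fT fle).
have [A0 ex] : exists A, f A = x by apply/fT.
pose h (B : {set 'I_(dim z)}) := [ffun i => if i \in B then None else A0 i].
exists 'I_(dim z), [set i | A0 i != None], (fun B => f (h B)); split.
- move=> u; split=> [/andP[]|[B _ <-]].
    move=> le_xu /fT[A eu]; subst u x.
    move: le_xu; rewrite fle => /forallP sA.
    exists [set i | (A0 i != None) && (A i == None)].
      by apply/subsetP => i; rewrite !inE => /andP[].
    congr f; apply/ffunP => i; rewrite ffunE inE.
    by have := sA i; case: (A0 i) (A i) => [[]|] [[]|].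
  apply/andP; split; last by apply/fT; exists (h B).
  rewrite -ex fle; apply/forallP => i; rewrite ffunE.
  by case: (i \in B); rewrite eqxx ?orbT.
- move=> A B; rewrite !powersetE => sA sB; rewrite fle.
  apply/forallP/subsetP => AB i; have := AB i; rewrite !ffunE.
    move=> + iA; have := subsetP sA i iA; rewrite inE iA.
    by case: (i \in B) => //; case: (A0 i).
  case: (i \in B) => //=.
  by case: (i \in A) => [/(_ isT)|]; rewrite ?eqxx ?orbT.
- move=> B; rewrite powersetE => sB; rewrite -ex !fdim.
  have dAB : [disjoint [set i | A0 i == None] & B].
    rewrite disjoint_sym disjoints_subset; apply: subset_trans sB _.
    by apply/subsetP => i; rewrite !inE.
  rewrite -(_ : [set i | A0 i == None] :|: B = [set i | h B i == None]).
    by rewrite cardsU (disjoint_setI0 dAB) cards0 subn0.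
  by apply/setP => i; rewrite !inE ffunE; case: ifP; rewrite ?orbT ?orbF.
Qed.

(** Supplies the hypothesis [dim_lt], the form in which the section on orientations uses the
    complex. *)
Lemma boolean_interval_dim_lt (x z : X) :
  boolean_interval x z -> (x < z)%O -> (dim x < dim z)%N.
Proof.
move=> [I [D [f [fT fle fdim]]]] lt_xz; have le_xz := ltW lt_xz.
have [B sB ez] : exists2 B : {set I}, B \subset D & f B = z by apply/fT; rewrite le_xz lexx.
rewrite -ez fdim ?powersetE // -addn1 leq_add2l card_gt0.
have [A sA ex] : exists2 A : {set I}, A \subset D & f A = x by apply/fT; rewrite le_xz lexx.
move: lt_xz; rewrite lt_leAnge -ez -ex; apply: contraTneq => ->.
by rewrite negb_and negbK !fle ?powersetE ?sub0set // orbT.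
Qed.

(** Boolean triples make every question of order, equality or dimension among the eight cells a
    finite case check. *)
Definition cube_coordinates (x z : X) (g : bool -> bool -> bool -> X) : Prop :=
  [/\ g false false false = x, g true true true = z,
      forall u, (x <= u <= z)%O -> exists p q r, u = g p q r,
      forall p q r p' q' r', (g p q r <= g p' q' r')%O =
        [&& p ==> p', q ==> q' & r ==> r'] &
      forall p q r, dim (g p q r) = (dim x + (p + q + r))%N].

Lemma boolean_interval_coordinates (x z : X) :
  boolean_interval x z -> (x <= z)%O -> dim z = (dim x + 3)%N ->
  exists g, cube_coordinates x z g.
Proof.
move=> [I [D [f [fT fle fdim]]]] le_xz dz.
have [B0 sB0 ez] : exists2 B : {set I}, B \subset D & f B = z by apply/fT; rewrite le_xz lexx.
have [A0 sA0 ex] : exists2 B : {set I}, B \subset D & f B = x by apply/fT; rewrite le_xz lexx.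
have fD : f D = z.
  apply: le_anti; have /fT/andP[_ ->] : exists2 B : {set I}, B \subset D & f B = f D by exists D.
  by rewrite -ez fle ?powersetE.
have f0 : f set0 = x.
  apply: le_anti; have /fT/andP[-> _] : exists2 B : {set I}, B \subset D & f B = f set0.
    by exists set0; rewrite ?sub0set.
  by rewrite -ex fle ?powersetE ?sub0set.
have : size (enum D) = 3.
  by move: dz; rewrite -fD fdim ?powersetE // -cardE => /addnI.
have := enum_uniq D; have : D =i enum D by move=> i; rewrite mem_enum.
case: (enum D) => [|a [|b [|c []]]] // eD /= /and3P[]; rewrite !inE.
rewrite negb_or => /andP[ab ac] bc _ _.
pose h p q r := [set i in D | (i == a) && p || (i == b) && q || (i == c) && r].
have hD p q r : h p q r \in powerset D.
  by rewrite powersetE; apply/subsetP => i; rewrite inE => /andP[].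
have ha p q r : (a \in h p q r) = p.
  by rewrite !inE eD !inE eqxx (negPf ab) (negPf ac) /= !orbF.
have hb p q r : (b \in h p q r) = q.
  by rewrite !inE eD !inE eqxx [b == a]eq_sym (negPf ab) (negPf bc) /= !orbF ?orbT.
have hc p q r : (c \in h p q r) = r.
  rewrite !inE eD !inE eqxx ![c == _]eq_sym (negPf ac).
  by rewrite (negPf bc) /= ?orbT.
have hE (B : {set I}) : B \subset D -> B = h (a \in B) (b \in B) (c \in B).
  move=> sB; apply/setP => i; case: (boolP (i \in D)) => iD; last first.
    rewrite [RHS]inE (negPf iD) /=; apply/negbTE; apply: contra iD => iB.
    exact: (subsetP sB).
  move: iD; rewrite eD inE in_cons mem_seq1.
  by move=> /or3P[] /eqP->; rewrite ?ha ?hb ?hc.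
exists (fun p q r => f (h p q r)); split.
- by rewrite -f0; congr f; apply/setP => i; rewrite !inE !andbF.
- rewrite -fD; congr f; apply/setP => i; rewrite inE !andbT eD !inE.
  by case: (i == a) (i == b) (i == c) => [] [] [].
- move=> u /fT[B sB <-]; exists (a \in B), (b \in B), (c \in B).
  by rewrite -hE.
- move=> p q r p' q' r'; rewrite fle //; apply/subsetP/and3P => [s|[sp sq sr] i].
    split; apply/implyP; [have := s a | have := s b | have := s c];
    by rewrite ?ha ?hb ?hc.
  move=> ih; have : i \in D by case/setIdP: ih.
  rewrite eD inE in_cons mem_seq1.
  by move=> /or3P[] /eqP e; move: ih; rewrite e ?ha ?hb ?hc; apply/implyP.
- move=> p q r; rewrite fdim //; congr addn.
  rewrite -sum1_card (eq_bigl (fun i => (i \in [:: a; b; c]) && (i \in h p q r))).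
    rewrite big_mkcondr /= -big_uniq /=; last by rewrite !inE negb_or ab ac bc.
    by rewrite !big_cons big_nil ha hb hc addn0 addnA; case: p q r => [] [] [].
  by move=> i /=; rewrite !inE eD !inE andbA andbb.
Qed.

(** The directions (a, b, c) become (c, a, b). Two rotations carry one lower and one upper face to
    all six. *)
Lemma cube_coordinates_rot (x z : X) g :
  cube_coordinates x z g -> cube_coordinates x z (fun p q r => g q r p).
Proof.
move=> [g0 g1 gx gle gdim]; split=> //.
- by move=> u /gx[p [q [r ->]]]; exists r, p, q.
- by move=> p q r p' q' r'; rewrite gle [LHS]andbA [LHS]andbC.
- by move=> p q r; rewrite gdim; congr addn; rewrite [LHS]addnC addnA.
Qed.

End Intervals.

(** Evaluates [normal_direction] and [parallel_direction], which pick a cell that turns out to be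
    the only candidate. *)
Lemma pick_unique (T : finType) (P : pred T) (c : T) :
  P =1 pred1 c -> [pick y | P y] = Some c.
Proof.
move=> e; rewrite (eq_pick e); case: pickP => [y /eqP-> //|/(_ c)].
by rewrite /= eqxx.
Qed.

(** The order in which [enum] lists two cells is unknown; both orders are treated wherever it enters
    a sign. *)
Lemma perm_pair (T : eqType) (s : seq T) (a b : T) :
  perm_eq s [:: a; b] -> s = [:: a; b] \/ s = [:: b; a].
Proof.
move=> p; have := perm_mem p; have := perm_size p; move: p.
case: s => [|x [|y []]] //= p _ /(_ x); rewrite !inE eqxx /= => /esym/orP[] /eqP e.
  subst x; left; move: p; rewrite perm_cons => /perm_mem/(_ y).
  by rewrite !inE eqxx => /esym/eqP->.
subst x; right; have : perm_eq [:: b; y] [:: b; a].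
  by apply: perm_trans p _; rewrite -(perm_catC [:: b] [:: a]).
by rewrite perm_cons => /perm_mem/(_ y); rewrite !inE eqxx => /esym/eqP->.
Qed.

(** * Incidence numbers of the cubes *)

Section Orientation.
Context {d : Order.disp_t} {X : finPOrderType d}.
Variables (dim : X -> nat) (o : orientation dim).
Hypothesis dim_lt : {homo dim : x y / (x < y)%O >-> (x < y)%N}.

Local Notation rel := (relative_orientation o).
Local Notation sgn := (frame_sign o).
Local Notation dirs := (directions dim).

Lemma dim_le (u v : X) : (u <= v)%O -> (dim u <= dim v)%N.
Proof. by rewrite le_eqVlt => /predU1P[->|/dim_lt/ltnW]. Qed.

Lemma le_dim_eq (u v : X) : (u <= v)%O -> (dim v <= dim u)%N -> u = v.
Proof. by rewrite le_eqVlt => /predU1P[//|/dim_lt]; rewrite ltnNge => /negPf->. Qed.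

Lemma mem_directions (S : cube X) (u : X) : (u \in dirs S) =
  [&& (lo S <= u)%O, dim u == (dim (lo S)).+1 & (u <= hi S)%O].
Proof. by rewrite inE /codim_face addn1 andbA. Qed.

Definition mkcube (u v : X) (le_uv : (u <= v)%O) : cube X := Sub (u, v) le_uv.

Lemma codim_face_mkcube (u v : X) (le_uv : (u <= v)%O) (S : cube X) :
    (lo S <= u)%O -> (v <= hi S)%O ->
  codim_face (cube_dim dim) 1 (mkcube le_uv) S = (cube_dim dim S == dim v - dim u + 1)%N.
Proof. by move=> lu vh; rewrite /codim_face /Order.le /= /cube_le lu vh. Qed.

Lemma cube_ext (S T : cube X) : lo S = lo T -> hi S = hi T -> S = T.
Proof.
rewrite /lo /hi => el eh; apply: val_inj.
by rewrite [LHS]surjective_pairing el eh -surjective_pairing.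
Qed.

Lemma lo_le_hi (S : cube X) : (lo S <= hi S)%O.
Proof. exact: valP S. Qed.

Lemma frame_sign_sqr (S : cube X) (s : seq X) : sgn S s * sgn S s = 1.
Proof. by rewrite /frame_sign; case: ifP. Qed.

Lemma frame_sign_swap (S : cube X) (s1 s2 : seq X) (a b : X) :
  frame dim S (s1 ++ [:: a, b & s2]) ->
  sgn S (s1 ++ [:: b, a & s2]) = - sgn S (s1 ++ [:: a, b & s2]).
Proof.
by move=> fr; rewrite /frame_sign (positive_swap o fr); case: positive; rewrite ?opprK.
Qed.

Lemma frame_uniq (S : cube X) (s : seq X) :
  uniq s -> s =i dirs S -> frame dim S s.
Proof.
move=> us es; apply: uniq_perm => // [|u]; first exact: enum_uniq.
by rewrite es mem_enum.
Qed.

(** On this face the coordinate along c is 0, so the normal c is inward, whence the minus sign. The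
    face shares its smallest vertex with S, so its directions are already directions of S. *)
Lemma relative_orientation_lower (S : cube X) (v c : X) (le_v : (lo S <= v)%O) :
    (v <= hi S)%O -> dim (hi S) = (dim v).+1 -> c \in dirs S -> ~~ (c <= v)%O ->
    (forall u, u \in dirs S -> u = c \/ (u <= v)%O) ->
  let s := enum (dirs (mkcube le_v)) in
  rel S (mkcube le_v) = - (sgn (mkcube le_v) s * sgn S (c :: s)).
Proof.
move=> le_vS dv cS cv dS s; rewrite /relative_orientation.
have -> : codim_face (cube_dim dim) 1 (mkcube le_v) S.
  rewrite codim_face_mkcube // /cube_dim dv.
  by rewrite addn1 subSn // dim_le.
have nc : normal_direction dim S (mkcube le_v) = c.
  rewrite /normal_direction (@pick_unique _ _ c) // => u /=.
  case: (boolP (u \in dirs S)) => uS /=; last first.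
    by apply/esym; apply: contraNF uS => /eqP->.
  have nlo : (u <= lo S)%O = false.
    apply: contraTF uS => le_u; rewrite mem_directions; apply/negP => /and3P[_ /eqP e _].
    by have := dim_le le_u; rewrite e ltnn.
  rewrite [lo _]/= nlo orbF; case: (dS u uS) => [->|le_u]; first by rewrite cv eqxx.
  by rewrite le_u; apply/esym; apply: contraNF cv => /eqP<-.
have pd u : u \in dirs (mkcube le_v) -> parallel_direction dim S (mkcube le_v) u = u.
  rewrite mem_directions /= => /and3P[lu du uv].
  rewrite /parallel_direction (@pick_unique _ _ u) // => b /=.
  rewrite mem_directions; apply/idP/eqP => [|->].
    case/andP=> /and3P[lb /eqP db _] /andP[bu _]; apply: (le_dim_eq bu).
    by rewrite db (eqP du).
  rewrite lu du (le_trans uv le_vS) lexx /=; apply/negP => /dim_le.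
  by rewrite (eqP du) ltnn.
rewrite -/s (_ : map _ _ = s); last first.
  by rewrite -[RHS]map_id; apply/eq_in_map => u; rewrite mem_enum; apply: pd.
rewrite nc /outward_sign nc [lo (mkcube _)]/=.
case: ifP => [le_c|_]; last by rewrite !mulNr mul1r.
by case/negP: cv; apply: (le_trans le_c).
Qed.

(** Here the coordinate along a is 1 and the normal is outward. The directions of the face start at
    a, so they have to be translated back to [lo S]. *)
Lemma relative_orientation_upper (S : cube X) (a : X) (le_a : (a <= hi S)%O) :
    a \in dirs S ->
  let s := enum (dirs (mkcube le_a)) in
  rel S (mkcube le_a) = sgn (mkcube le_a) s *
    sgn S (a :: [seq parallel_direction dim S (mkcube le_a) c | c <- s]).
Proof.
move=> aS s; have := aS; rewrite mem_directions => /and3P[la /eqP da _].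
rewrite /relative_orientation.
have -> : codim_face (cube_dim dim) 1 (mkcube le_a) S.
  rewrite codim_face_mkcube // /cube_dim da.
  by have := dim_le le_a; rewrite da addn1 => lt; rewrite subnSK.
have na : normal_direction dim S (mkcube le_a) = a.
  rewrite /normal_direction (@pick_unique _ _ a) // => u /=.
  rewrite mem_directions; apply/idP/eqP => [|->]; last by rewrite la da eqxx le_a lexx orbT.
  case/andP=> /and3P[_ /eqP du ->] /= ua; apply: (le_dim_eq ua).
  by rewrite da du.
by rewrite -/s na /outward_sign na lexx mul1r.
Qed.

Lemma parallel_direction_upper (S : cube X) (a b w : X) (le_a : (a <= hi S)%O) :
    b \in dirs S -> (forall u, u \in dirs S -> ((u <= w)%O && ~~ (u <= a)%O) = (u == b)) ->
  parallel_direction dim S (mkcube le_a) w = b.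
Proof.
move=> bS uP; rewrite /parallel_direction (@pick_unique _ _ b) // => u /=.
case: (boolP (u \in dirs S)) => [/uP//|] uS /=.
by apply/esym; apply: contraNF uS => /eqP->.
Qed.

(** * Edges and the direction in which a boundary runs through them *)

Section Edge.
Variables (u v : X) (le_uv : (u <= v)%O).
Hypothesis dim_v : dim v = (dim u).+1.
Local Notation E := (mkcube le_uv).

Lemma directions_edge : dirs E = [set v].
Proof.
apply/setP => w; rewrite mem_directions inE /=; apply/and3P/eqP => [[_ /eqP dw le_w]|->].
  by apply: (le_dim_eq le_w); rewrite dw dim_v.
by rewrite le_uv dim_v eqxx lexx.
Qed.

Lemma directions_vertex (w : X) : dirs (vertex w) = set0.
Proof.
apply/setP => c; rewrite mem_directions inE; apply/negP => /and3P[_ /eqP dc /dim_le].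
by rewrite dc ltnn.
Qed.

Lemma frame_sign_vertex (w : X) : sgn (vertex w) [::] = 1.
Proof. by rewrite /frame_sign positive_vertex. Qed.

Lemma relative_orientation_hi : rel E (vertex v) = sgn E [:: v].
Proof.
have := @relative_orientation_upper E v (lexx v).
rewrite directions_edge inE eqxx => /(_ isT) /=.
have -> : mkcube (lexx v) = vertex v by apply: cube_ext.
by rewrite directions_vertex enum_set0 frame_sign_vertex mul1r => ->.
Qed.

Lemma relative_orientation_lo : rel E (vertex u) = - sgn E [:: v].
Proof.
have := @relative_orientation_lower E u v (lexx u) le_uv dim_v.
rewrite directions_edge inE eqxx => /(_ isT).
have -> : ~~ (v <= u)%O by apply/negP => /dim_le; rewrite dim_v ltnn.
have -> : mkcube (lexx u) = vertex u by apply: cube_ext.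
rewrite directions_vertex enum_set0 /= frame_sign_vertex mul1r => -> // w.
by rewrite inE => /eqP->; left.
Qed.

(** Removes the existential quantifier over edges in [boundary_runs]. *)
Lemma edge_unique (E' : cube X) : (vertex u <= E')%O -> (vertex v <= E')%O ->
  cube_dim dim E' = 1%N -> E' = E.
Proof.
rewrite /Order.le /= /cube_le /lo /hi /= => /andP[lu uh] /andP[lv vh] dE.
have := dim_le lu; have := dim_le vh; rewrite /cube_dim in dE.
rewrite dim_v => dh dl; have := lo_le_hi E'; move/dim_le => dlh.
have dE' : dim (hi E') = (dim (lo E')).+1 by rewrite -(subnK dlh) dE.
apply: cube_ext; rewrite /= /lo /hi.
  by apply: (le_dim_eq lu); rewrite -ltnS; apply: leq_trans dh _; rewrite -dE'.
apply/esym/(le_dim_eq vh); rewrite dim_v; move: dE'; rewrite /lo /hi => ->.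
by rewrite ltnS.
Qed.

Variable S : cube X.
Hypothesis dim_S : cube_dim dim S = 2.
Hypothesis face_E : codim_face (cube_dim dim) 1 E S.

Lemma vertex_edge (w : X) : (u <= w <= v)%O -> (vertex w <= E)%O.
Proof. by rewrite [(vertex w <= _)%O]/Order.le /= /cube_le /lo /hi /=. Qed.

Lemma edge_neq : u != v.
Proof. by apply/eqP => e; move: dim_v; rewrite e => /eqP; rewrite eqn_leq ltnn andbF. Qed.

Lemma boundary_runs_up : boundary_runs o S u v = (rel S E * sgn E [:: v] == 1).
Proof.
apply/existsP/eqP => [[E' /and5P[fE' uE' vE' _ /eqP <-]]|e].
  rewrite (edge_unique uE' vE') ?relative_orientation_hi //.
  by case/andP: fE' => _; rewrite dim_S addn1 eqSS => /eqP.
exists E; rewrite face_E !vertex_edge ?lexx ?le_uv // edge_neq.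
by rewrite relative_orientation_hi e eqxx.
Qed.

Lemma boundary_runs_down : boundary_runs o S v u = (- (rel S E * sgn E [:: v]) == 1).
Proof.
rewrite -mulrN -relative_orientation_lo.
apply/existsP/eqP => [[E' /and5P[fE' vE' uE' _ /eqP <-]]|e].
  rewrite (edge_unique uE' vE') //.
  by case/andP: fE' => _; rewrite dim_S addn1 eqSS => /eqP.
exists E; rewrite face_E !vertex_edge ?lexx ?le_uv // eq_sym edge_neq.
by rewrite e eqxx.
Qed.

End Edge.

Lemma frame_sign_swap2 (S : cube X) (a b : X) :
  frame dim S [:: a; b] -> sgn S [:: b; a] = - sgn S [:: a; b].
Proof. exact: (@frame_sign_swap S [::]). Qed.

(** A 3-cycle is a product of two transpositions. *)
Lemma frame_sign_rot3 (S : cube X) (a b c : X) :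
  frame dim S [:: a; b; c] -> sgn S [:: b; c; a] = sgn S [:: a; b; c].
Proof.
move=> fr; rewrite (@frame_sign_swap S [:: b] [::] a c) /=.
  by rewrite (@frame_sign_swap S [::] [:: c] a b) //= opprK.
by apply: perm_trans fr; rewrite (perm_catCA [:: b] [:: a]).
Qed.

Definition middle_cells (S : cube X) (a b : X) : Prop :=
  a != b /\ forall u, codim_face dim 1 (lo S) u && codim_face dim 1 u (hi S)
                      = (u == a) || (u == b).

Lemma middle_cellsC (S : cube X) (a b : X) : middle_cells S a b -> middle_cells S b a.
Proof. by case=> ab mS; split=> [|u]; [rewrite eq_sym | rewrite mS orbC]. Qed.

(** * Oriented squares *)

Section Square.
Variable S : cube X.
Hypothesis dim_S : cube_dim dim S = 2.

Lemma directions_square (a b : X) : middle_cells S a b -> dirs S = [set a; b].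
Proof.
case=> ab mS; apply/setP => u; rewrite mem_directions !inE -mS /codim_face !addn1.
case: (lo S <= u)%O => //=; case: eqP => //= du; case: (u <= hi S)%O => //=.
by rewrite du -(subnK (dim_le (lo_le_hi S))) -/(cube_dim dim S) dim_S eqxx.
Qed.

Lemma frame_square (a b : X) : middle_cells S a b -> frame dim S [:: a; b].
Proof.
move=> mS; apply: frame_uniq; first by rewrite /= inE (proj1 mS).
by move=> u; rewrite (directions_square mS) !inE.
Qed.

(** The two edges through a are traversed upwards exactly when the frame (a, b) is positive: [rl]
    treats the edge b = 0 and [ru] the edge a = 1. In each, the frame sign of the edge occurs twice
    and cancels. Exchanging a and b gives the other two edges. *)
Lemma boundary_runs_square (a b : X) : middle_cells S a b ->
  [/\ boundary_runs o S (lo S) a = (sgn S [:: a; b] == 1),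
      boundary_runs o S a (hi S) = (sgn S [:: a; b] == 1),
      boundary_runs o S (hi S) a = (sgn S [:: b; a] == 1) &
      boundary_runs o S a (lo S) = (sgn S [:: b; a] == 1)].
Proof.
move=> mS; have [ab mE] := mS; have dS := directions_square mS.
have /andP[/andP[la /eqP da] /andP[ah /eqP dh]] :
  codim_face dim 1 (lo S) a && codim_face dim 1 a (hi S) by rewrite mE eqxx.
have /andP[/andP[lb /eqP db] /andP[bh /eqP dh']] :
  codim_face dim 1 (lo S) b && codim_face dim 1 b (hi S) by rewrite mE eqxx orbT.
rewrite !addn1 in da db dh dh'.
have nba : ~~ (b <= a)%O.
  by apply: contra ab => /le_dim_eq ->; rewrite // da db.
have nab : ~~ (a <= b)%O.
  by apply: contra ab => /le_dim_eq ->; rewrite // da db.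
have aS : a \in dirs S by rewrite dS !inE eqxx.
have bS : b \in dirs S by rewrite dS !inE eqxx orbT.
have fl : codim_face (cube_dim dim) 1 (mkcube la) S.
  by rewrite codim_face_mkcube // dim_S da subSnn.
have fu : codim_face (cube_dim dim) 1 (mkcube ah) S.
  by rewrite codim_face_mkcube // dim_S dh subSnn.
have rl : rel S (mkcube la) * sgn (mkcube la) [:: a] = sgn S [:: a; b].
  rewrite (relative_orientation_lower la ah dh bS nba) => [|u]; last first.
    by rewrite dS !inE => /orP[] /eqP->; [right | left].
  rewrite directions_edge // enum_set1 (frame_sign_swap2 (frame_square mS)).
  by rewrite mulrN opprK mulrAC frame_sign_sqr mul1r.
have ru : rel S (mkcube ah) * sgn (mkcube ah) [:: hi S] = sgn S [:: a; b].
  rewrite relative_orientation_upper // directions_edge // enum_set1 /=.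
  rewrite (@parallel_direction_upper _ _ b) // => [|u]; last first.
    rewrite dS !inE => /orP[] /eqP->; first by rewrite lexx andbF (negPf ab).
    by rewrite bh nba eqxx.
  by rewrite mulrAC frame_sign_sqr mul1r.
rewrite (boundary_runs_up da dim_S fl) (boundary_runs_up dh dim_S fu).
rewrite (boundary_runs_down da dim_S fl) (boundary_runs_down dh dim_S fu) rl ru.
by rewrite (frame_sign_swap2 (frame_square mS)).
Qed.

End Square.

(** * The curvature on the faces of a 3-cube *)

Section Curvature.
Variables (K : fieldType) (L : @bundle d X K) (t : transport L).

(** The cyclic order in the definition of the curvature is the boundary order exactly when (a, b) is
    a positive frame. Exchanging a and b negates both the difference and the sign, so the
    enumeration order does not matter. *)
Lemma curvatureE (Q : k_cell (cube_dim dim) 2) (a b : X) : middle_cells (val Q) a b ->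
  curvature o t Q =
    (lin_comp (t (hi (val Q)) a) (t a (lo (val Q))) -
     lin_comp (t (hi (val Q)) b) (t b (lo (val Q)))) *~ sgn (val Q) [:: a; b].
Proof.
move=> mQ; have dQ : cube_dim dim (val Q) = 2 := eqP (valP Q).
have main a' b' : middle_cells (val Q) a' b' ->
  (if cycle (boundary_runs o (val Q)) [:: lo (val Q); a'; hi (val Q); b']
   then 1 else -1) = sgn (val Q) [:: a'; b'].
  move=> mQ'; have [r1 r2 _ _] := boundary_runs_square dQ mQ'.
  have [_ _ r3 r4] := boundary_runs_square dQ (middle_cellsC mQ').
  by rewrite /= r1 r2 r3 r4 andbT !andbb /frame_sign; case: positive.
have pab : perm_eq (enum [set T' | codim_face dim 1 (lo (val Q)) T' &&
                                    codim_face dim 1 T' (hi (val Q))]) [:: a; b].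
  apply: uniq_perm; rewrite ?enum_uniq //= ?inE ?(proj1 mQ) //.
  by move=> u; rewrite mem_enum inE (proj2 mQ) !inE.
rewrite /curvature; have [->|->] := perm_pair pab; first by rewrite main.
rewrite (main _ _ (middle_cellsC mQ)) (frame_sign_swap2 (frame_square dQ mQ)).
by rewrite mulrNz -mulNrz opprB.
Qed.

Lemma lin_mulrzE (U V : lmodType K) (f : Lin U V) (n : int) (y : U) :
  (f *~ n) y = f y *~ n.
Proof. by rewrite -[f *~ n]scaler_int linZE scaler_int. Qed.

Lemma End_transport_lower (S : cube X) (v : X) (le_v : (lo S <= v)%O)
    (u : End_bundle L (mkcube le_v)) (y : L (lo S)) :
  (End_transport t S (mkcube le_v) u : Lin _ _) y = t (hi S) v ((u : Lin _ _) y).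
Proof.
rewrite -[End_transport _ _ _ _]/(End_transport_fun t S u) /End_transport_fun.
by rewrite -[lo (mkcube _)]/(lo S) eqxx /= fibre_cast_id.
Qed.

Lemma End_transport_upper (S : cube X) (a : X) (le_a : (a <= hi S)%O)
    (u : End_bundle L (mkcube le_a)) (y : L (lo S)) : a != lo S ->
  (End_transport t S (mkcube le_a) u : Lin _ _) y = (u : Lin _ _) (t a (lo S) y).
Proof.
move=> /negPf aS.
rewrite -[End_transport _ _ _ _]/(End_transport_fun t S u) /End_transport_fun.
by rewrite -[lo (mkcube _)]/a aS /= fibre_cast_id.
Qed.

Definition transport_path (S : cube X) (a v : X) : Lin (L (lo S)) (L (hi S)) :=
  lin_comp (t (hi S) v) (lin_comp (t v a) (t a (lo S))).

Definition face_term (S : cube X) (Q : k_cell (cube_dim dim) 2) :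
    Lin (L (lo S)) (L (hi S)) :=
  End_transport t S (val Q) (curvature o t Q) *~ rel S (val Q).

Section Cube.
Variables (S : cube X) (g : bool -> bool -> bool -> X).
Hypothesis g_coord : cube_coordinates dim (lo S) (hi S) g.

Lemma coord_le p q r p' q' r' :
  (g p q r <= g p' q' r')%O = [&& p ==> p', q ==> q' & r ==> r'].
Proof. by case: g_coord => _ _ _ ->. Qed.

Lemma coord_eq p q r p' q' r' :
  (g p q r == g p' q' r') = [&& p == p', q == q' & r == r'].
Proof.
by rewrite eq_le !coord_le; case: p p' q q' r r' => [] [] [] [] [] [].
Qed.

Lemma coord_dim p q r : dim (g p q r) = (dim (lo S) + (p + q + r))%N.
Proof. by case: g_coord. Qed.

Lemma coord_lo : lo S = g false false false. Proof. by case: g_coord. Qed.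
Lemma coord_hi : hi S = g true true true. Proof. by case: g_coord. Qed.

Lemma coord_ex u : (lo S <= u <= hi S)%O -> exists p q r, u = g p q r.
Proof. by case: g_coord => _ _ /(_ u). Qed.

Local Notation a := (g true false false).
Local Notation b := (g false true false).
Local Notation c := (g false false true).

Lemma directions_cube : dirs S =i [:: a; b; c].
Proof.
move=> u; rewrite mem_directions; apply/idP/idP.
  case/and3P=> lu /eqP du uh; have [|p [q [r e]]] := @coord_ex u; first by rewrite lu.
  move: du; rewrite e coord_dim -addn1 => /addnI.
  by case: p q r {e} => [] [] [] //; rewrite !inE eqxx ?orbT.
by rewrite !inE => /or3P[] /eqP->; rewrite coord_hi {1}coord_lo !coord_le coord_dim addn1 eqxx.
Qed.

Lemma frame_cube : frame dim S [:: a; b; c].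
Proof.
apply: frame_uniq; first by rewrite /= !inE !coord_eq.
by move=> u; rewrite directions_cube.
Qed.

(** The face at c = 0. Its two paths share the last step, from ab to [hi S]; the inward normal
    exchanges them. *)
Lemma lower_face : exists Q : k_cell (cube_dim dim) 2,
  [/\ lo (val Q) = lo S, hi (val Q) = g true true false &
      face_term S Q = (transport_path S b (g true true false) -
        transport_path S a (g true true false)) *~ sgn S [:: a; b; c]].
Proof.
have le_v : (lo S <= g true true false)%O by rewrite coord_lo coord_le.
have dQ : cube_dim dim (mkcube le_v) == 2.
  by rewrite /cube_dim /= coord_dim addKn.
pose Q : k_cell (cube_dim dim) 2 := exist _ (mkcube le_v) dQ.
exists Q; split=> //.
have mQ : middle_cells (val Q) a b.
  split=> [|u]; first by rewrite coord_eq.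
  rewrite -[lo _]/(lo S) -[hi _]/(g true true false); apply/idP/idP; last first.
    rewrite /codim_face.
    by case/orP=> /eqP->; rewrite {1}coord_lo !coord_le !coord_dim -?addnA !eqxx.
  case/andP=> /andP[lu du] /andP[uv _].
  have [|p [q [r e]]] := @coord_ex u.
    by rewrite lu (le_trans uv) // coord_hi coord_le.
  move: du uv; rewrite e coord_dim coord_le eqn_add2l !coord_eq.
  by case: p q r {e} => [] [] [].
have rQ : rel S (val Q) = - (sgn (val Q) [:: a; b] * sgn S [:: a; b; c]).
  rewrite /= (relative_orientation_lower le_v (c := c)) ?coord_le //.
  (* The frame (c, a, b) is a rotation of (a, b, c). If [enum] lists b before a, the signs on Q and
     on S both change and their product is the same. *)
  - rewrite -(frame_sign_rot3 frame_cube) -(frame_sign_rot3 (a := b)); last first.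
      by apply: perm_trans frame_cube; rewrite (perm_catC [:: b; c] [:: a]).
    have := frame_square (eqP dQ) mQ; rewrite /frame perm_sym => /perm_pair[] -> //.
    rewrite (frame_sign_swap2 (frame_square (eqP dQ) mQ)).
    rewrite (@frame_sign_swap S [:: c] [::] a b) ?mulrNN //.
    by apply: perm_trans frame_cube; rewrite (perm_catC [:: c] [:: a; b]).
  - by rewrite coord_hi coord_le.
  - by rewrite coord_hi !coord_dim -addnS.
  - by rewrite directions_cube !inE eqxx !orbT.
  - move=> u; rewrite directions_cube !inE => /or3P[] /eqP->;
      [right | right | left] => //; by rewrite coord_le.
rewrite /face_term (curvatureE mQ) rQ; apply: LinP => y.
rewrite !lin_mulrzE End_transport_lower lin_mulrzE !linDE !linNE raddfMz raddfB /= -mulrzA.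
by rewrite mulrN mulrA frame_sign_sqr mul1r mulrNz -mulNrz opprB.
Qed.

(** The face at a = 1. Its two paths share the first step, from [lo S] to a, and its directions ab
    and ac are parallel to b and c. *)
Lemma upper_face : exists Q : k_cell (cube_dim dim) 2,
  [/\ lo (val Q) = a, hi (val Q) = hi S &
      face_term S Q = (transport_path S a (g true true false) -
        transport_path S a (g true false true)) *~ sgn S [:: a; b; c]].
Proof.
have le_a : (a <= hi S)%O by rewrite coord_hi coord_le.
have dQ : cube_dim dim (mkcube le_a) == 2.
  by rewrite /cube_dim -[hi _]/(hi S) -[lo _]/a coord_hi !coord_dim subnDl.
pose Q : k_cell (cube_dim dim) 2 := exist _ (mkcube le_a) dQ.
exists Q; split=> //.
have mQ : middle_cells (val Q) (g true true false) (g true false true).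
  split=> [|u]; first by rewrite coord_eq.
  rewrite -[lo _]/a -[hi _]/(hi S); apply/idP/idP; last first.
    rewrite /codim_face.
    by case/orP=> /eqP->; rewrite coord_hi !coord_le !coord_dim -?addnA !eqxx.
  case/andP=> /andP[lu du] /andP[uv _].
  have [|p [q [r e]]] := @coord_ex u.
    by rewrite uv andbT (le_trans _ lu) // coord_lo coord_le.
  move: du lu; rewrite e !coord_dim addn1 -addnS coord_le eqn_add2l !coord_eq.
  by case: p q r {e} => [] [] [].
have aS : a \in dirs S by rewrite directions_cube !inE eqxx.
have pb : parallel_direction dim S (mkcube le_a) (g true true false) = b.
  apply: parallel_direction_upper => [|u]; rewrite directions_cube !inE ?eqxx ?orbT //.
  by case/or3P=> /eqP->; rewrite !coord_le coord_eq.
have pc : parallel_direction dim S (mkcube le_a) (g true false true) = c.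
  apply: parallel_direction_upper => [|u]; rewrite directions_cube !inE ?eqxx ?orbT //.
  by case/or3P=> /eqP->; rewrite !coord_le coord_eq.
have rQ : rel S (val Q) =
    sgn (val Q) [:: g true true false; g true false true] * sgn S [:: a; b; c].
  rewrite /= relative_orientation_upper //.
  have := frame_square (eqP dQ) mQ; rewrite /frame perm_sym => /perm_pair[] -> /=.
    by rewrite pb pc.
  rewrite pb pc (frame_sign_swap2 (frame_square (eqP dQ) mQ)).
  by rewrite (@frame_sign_swap S [:: a] [::] b c) ?mulrNN // frame_cube.
rewrite /face_term (curvatureE mQ) rQ; apply: LinP => y.
rewrite !lin_mulrzE End_transport_upper; last by rewrite coord_lo coord_eq.
rewrite lin_mulrzE !linDE !linNE /= -mulrzA.
by rewrite mulrA frame_sign_sqr mul1r.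
Qed.

End Cube.

End Curvature.

End Orientation.

(** * Summation over the six faces *)

Lemma boolean_complex (d : Order.disp_t) (X : finPOrderType d) (dim : X -> nat) :
    simplicial_complex dim \/ cubical_complex dim ->
  forall x z : X, (x <= z)%O -> boolean_interval dim x z.
Proof.
by case=> cplx x z; [apply: simplicial_boolean | apply: cubical_boolean].
Qed.

Theorem theorem2p3 (d : Order.disp_t) (X : finPOrderType d) (dim : X -> nat)
  (complex_X : simplicial_complex dim \/ cubical_complex dim)
  (K : fieldType) (L : bundle K) (t : transport L)
  (connection_t : is_connection dim t) (o : orientation dim)
  (S : k_cell (cube_dim dim) 3) :
  covariant_derivative (relative_orientation o) (End_transport t) (curvature o t) S
  = 0.
Proof.
have boolX := boolean_complex complex_X.
have dim_lt : {homo dim : x y / (x < y)%O >-> (x < y)%N}.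
  by move=> x y xy; apply: boolean_interval_dim_lt (xy); apply/boolX/ltW.
have le_S := lo_le_hi (val S).
have dim_S : dim (hi (val S)) = (dim (lo (val S)) + 3)%N.
  rewrite -(subnK (dim_le dim_lt le_S)) -/(cube_dim dim (val S)) (eqP (valP S)).
  exact: addnC.
have [g gS] := boolean_interval_coordinates (boolX _ _ le_S) le_S dim_S.
have gS1 := cube_coordinates_rot gS; have gS2 := cube_coordinates_rot gS1.
have [Q1 [l1 h1 e1]] := lower_face o dim_lt t gS.
have [Q2 [l2 h2 e2]] := upper_face o dim_lt t gS.
have [Q3 [l3 h3 e3]] := lower_face o dim_lt t gS1.
have [Q4 [l4 h4 e4]] := upper_face o dim_lt t gS1.
have [Q5 [l5 h5 e5]] := lower_face o dim_lt t gS2.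
have [Q6 [l6 h6 e6]] := upper_face o dim_lt t gS2.
rewrite /covariant_derivative.
(* A face is determined by its endpoints, two Boolean triples. Among the 64 pairs, the comparable
   ones of rank difference 2 are the six listed. *)
have faces T : codim_face (cube_dim dim) 1 (val T) (val S) =
    (T \in [:: Q1; Q2; Q3; Q4; Q5; Q6]).
  have TE Q : (T == Q) = (lo (val T) == lo (val Q)) && (hi (val T) == hi (val Q)).
    apply/eqP/andP => [->|[/eqP el /eqP eh]]; first by rewrite !eqxx.
    exact/val_inj/cube_ext.
  rewrite !inE !TE l1 l2 l3 l4 l5 l6 h1 h2 h3 h4 h5 h6.
  rewrite (coord_lo gS) (coord_hi gS) /codim_face (eqP (valP S)) (eqP (valP T)) andbT.
  rewrite /Order.le /= /cube_le.
  apply/idP/idP; last first.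
    by do 5?case/orP; case/andP=> /eqP-> /eqP->;
      rewrite ?(coord_lo gS) ?(coord_hi gS) !(coord_le gS).
  case/andP=> lT hT; have lhT := lo_le_hi (val T).
  have [|p [q [r el]]] := @coord_ex _ _ _ _ _ gS (lo (val T)).
    by rewrite lT (le_trans lhT).
  have [|p' [q' [r' eh]]] := @coord_ex _ _ _ _ _ gS (hi (val T)).
    by rewrite hT (le_trans lT).
  move: lhT (valP T); rewrite /cube_dim el eh !(coord_dim gS) subnDl.
  rewrite (coord_le gS) !(coord_eq gS).
  by case: p q r p' q' r' {el eh} => [] [] [] [] [] [].
rewrite (eq_bigl _ _ faces) -big_uniq; last first.
  have := map_uniq (f := fun T : k_cell (cube_dim dim) 2 => (lo (val T), hi (val T))).
  apply; rewrite /= l1 l2 l3 l4 l5 l6 h1 h2 h3 h4 h5 h6 !inE !xpair_eqE.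
  by rewrite (coord_lo gS) (coord_hi gS) !(coord_eq gS).
rewrite !big_cons big_nil.
(* The faces are listed in the cyclic order of the hexagon.                   *)
rewrite -[LHS]/(face_term o t (val S) Q1 + (face_term o t (val S) Q2 +
  (face_term o t (val S) Q3 + (face_term o t (val S) Q4 +
  (face_term o t (val S) Q5 + (face_term o t (val S) Q6 + 0)))))).
(* The frames (b, c, a) and (c, a, b) of the rotated coordinates have the sign of (a, b, c), which
   is then factored out of the telescoping sum. *)
rewrite addr0 e1 e2 e3 e4 e5 e6 (frame_sign_rot3 o (frame_cube gS)).
rewrite -(frame_sign_rot3 o (frame_cube gS1)) -!mulrzDl !addrA !subrK subrr.
exact: mul0rz.
Qed.
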